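(* Let $(c_n)_{n\ge 0}$ be a sequence of complex numbers such that the power series $\sum_{n=0}^\infty n!\,c_n z^n$ defines an entire function (i.e. converges for every $z\in\mathbb{C}$), and suppose the coefficients $c_n$ do not terminate. Then the function $f(z)=\sum_{n=0}^\infty c_n z^n$ is entire and has infinitely many zeros in $\mathbb{C}$.
   Context: A sequence $(c_n)_{n\ge 0}$ does not terminate if $c_n\neq 0$ for infinitely many $n$. *)

(* Defs.v *)
From Stdlib Require Import Reals List.
From Coquelicot Require Import Coquelicot.

Definition is_finite {T : Type} (P : T -> Prop) : Prop :=
  exists l : list T, forall x : T, P x -> In x l.

Definition infinitely_many {T : Type} (P : T -> Prop) : Prop := ~ is_finite P.

Definition does_not_terminate (c : nat -> C) : Prop :=
  infinitely_many (fun n : nat => c n <> RtoC 0).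

(* The scalar field is [C], so [ex_derive] is complex differentiability. *)
Definition entire (f : C -> C) : Prop :=
  forall z : C, @ex_derive C_AbsRing C_NormedModule f z.

(* [f] is the pointwise sum, over the whole plane, of the series with
   coefficients [c]; such an [f] is unique when it exists. *)
Definition is_power_series_sum (c : nat -> C) (f : C -> C) : Prop :=
  forall z : C, @is_pseries C_AbsRing C_NormedModule c z (f z).

(* Main.v *)
Require Import Defs.
From Stdlib Require Import Reals Factorial.
From Coquelicot Require Import Coquelicot.
From Stdlib Require Import Lra Lia List Classical ClassicalEpsilon.
From Stdlib Require Import FunctionalExtensionality.
From mathcomp Require all_boot all_order all_algebra ring complex Rstruct.

(** Convergence of [\sum n! c_n z^n] everywhere says that [c_n n! = O(e^n)] for
    every [e > 0]; hence [f(z) = \sum c_n z^n] satisfies [f(z) = O(exp(e |z|))]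
    for every [e > 0], that is, [f] has minimal exponential type. Such a
    function with finitely many zeros is a polynomial: classically, its
    Hadamard factorization is a polynomial times [exp(bz)], and minimal type
    forces [b = 0]. So [c] would terminate.

    The proof replaces Hadamard's theorem by an estimate on polynomials.
    Division by [z - a] ([quotient], [eval_quotient]) preserves minimal type,
    and cannot succeed for ever at the same point unless the series vanishes
    ([zero_of_infinite_order]); so the zeros can be divided out, and it remains
    to see that a series [h] of minimal type without zeros is constant. One may
    suppose [h(0) = 1].

    On the disc of radius [r] the modulus of [h] has a positive lower bound, so
    a Taylor polynomial [p] of large degree has no zeros there
    ([psum_zero_free]). Write [p] as a product of factors [1 - b z] with
    [|b| < 1 / r]. By the maximum principle, the number of [b] with
    [|b| >= 2 / rho] is at most linear in [rho], uniformly in the degree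
    ([exp2_count_le]), which makes [\sum |b|^2] of order [1 / r]
    ([sum_sq_le_of_count]). But [p'/p = - \sum b - z \sum b^2 / (1 - b z)], so
    the first coefficients of [p' - p'(0) p] are of order [1 / r]
    ([coef_prod_recurrence]). These are also coefficients of [h' - h'(0) h];
    letting [r] tend to infinity gives [h' = h'(0) h]. Thus [h(z) = exp(bz)]
    with [b = h'(0)], and minimal type gives [b = 0]. *)

(** * Zeros and coefficients of a complex polynomial *)

Module ComplexPolynomials.
Import all_boot all_order all_algebra ring.
Import Order.TTheory GRing.Theory Num.Theory.
Set Implicit Arguments.
Unset Strict Implicit.
Unset Printing Implicit Defensive.
Local Open Scope ring_scope.

(** The maximum principle at the centre of a disc, by descent on the degree.
    The even part [e] of [p] satisfies [e.[z ^+ 2] = (p.[z] + p.[- z]) / 2], so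
    a bound for [p] on the circle of radius [rho] bounds [e] on the circle of
    radius [rho ^+ 2], every point of which is a square; [e] has half the
    degree of [p] and the same value at [0]. *)
Lemma le_horner0 (K : numClosedFieldType) (p : {poly K}) (rho M : K) :
  (forall z, `|z| = rho -> `|p.[z]| <= M) -> 0 <= rho -> `|p.[0]| <= M.
Proof.
have [n le_pn] := ubnP (size p); elim: n p rho le_pn => // n IHn p rho le_pn HM rho0.
have [/size1_polyC p1|p1] := leqP (size p) 1.
  by have := HM rho; rewrite p1 !hornerC ger0_norm //; apply.
have -> : p.[0] = (even_poly p).[0].
  by rewrite -{1}(poly_even_odd p) hornerE !horner_comp !hornerE expr0n.
apply: (IHn _ (rho ^+ 2)) => [|w Hw|]; last by rewrite exprn_ge0.
  apply: leq_ltn_trans (size_even_poly p) _; rewrite ltnS in le_pn.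
  apply: leq_trans le_pn.
  by rewrite ltn_uphalf_double -addnn -add1n -addSnnS leq_add2r.
pose z := sqrtC w.
have zz : z ^+ 2 = w by rewrite sqrtCK.
have nz : `|z| = rho.
  by apply/eqP; rewrite -(@eqrXn2 _ 2) ?normr_ge0 // -normrX zz Hw.
have -> : (even_poly p).[w] = (p.[z] + p.[- z]) / 2.
  rewrite -{2 3}(poly_even_odd p) !hornerE !horner_comp !hornerE /= sqrrN zz.
  by rewrite mulrN -addrA addrACA subrr addr0 -mulr2n -[_ *+ 2]mulr_natr mulfK // pnatr_eq0.
rewrite normrM normfV (ger0_norm (ler0n _ 2)) ler_pdivrMr ?ltr0n // mulr_natr mulr2n.
by apply: le_trans (ler_normD _ _) _; rewrite lerD ?HM ?normrN.
Qed.

(** On a circle about [0], reflecting the root [b^-1] in the circle does not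
    change the modulus of the factor, while its value at [0] goes from [1] to
    [rho * b^*]. *)
Lemma norm_reflect (K : numClosedFieldType) (rho b z : K) :
  0 < rho -> `|z| = rho -> `|1 - b * z| = `|rho * b^* - z / rho|.
Proof.
move=> rho0 nz.
have zz : z * z^* = rho ^+ 2 by rewrite -normCK nz.
have r0 : rho != 0 by rewrite gt_eqF.
have rc : rho^* = rho by rewrite conj_Creal // gtr0_real.
have -> : 1 - b * z = - (z / rho) * (rho * b^* - z / rho)^*.
  rewrite rmorphB !rmorphM /= fmorphV /= conjCK rc.
  transitivity (z * z^* / rho ^+ 2 - b * z); last by field.
  by rewrite zz mulfV // expf_neq0.
rewrite normrM normrN normrM normfV nz norm_conjC.
by rewrite (ger0_norm (ltW rho0)) mulfV // mul1r.
Qed.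

(** Half of Jensen's formula, in multiplicative form: the roots [b^-1] of
    modulus at most [rho / 2] are reflected in the circle of radius [rho].
    The new polynomial has the same modulus on the circle, and each reflected
    factor contributes at least [2] to the modulus of its value at [0]. *)
Lemma exp2_count_le (K : numClosedFieldType) (bs : seq K) (rho M : K) :
  0 < rho ->
  (forall z, `|z| = rho -> `|\prod_(b <- bs) (1 - b * z)| <= M) ->
  2 ^+ count (fun b => 2 <= rho * `|b|) bs <= M.
Proof.
move=> rho0 HM.
pose fac (b : K) : {poly K} :=
  if 2 <= rho * `|b| then (rho * b^*)%:P - rho^-1 *: 'X else 1 - b *: 'X.
pose q := \prod_(b <- bs) fac b.
have Hq z : `|z| = rho -> `|q.[z]| <= M.
  move=> nz; apply: le_trans (HM z nz).
  rewrite horner_prod !normr_prod le_eqVlt; apply/orP; left; apply/eqP.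
  apply: eq_bigr => b _; rewrite /fac; case: ifP => _; rewrite !hornerE //.
  by rewrite (norm_reflect _ rho0 nz) [_^-1 * z]mulrC.
apply: le_trans (le_horner0 Hq (ltW rho0)).
rewrite /q horner_prod normr_prod.
elim: bs {HM q Hq} => [|b bs IHbs]; first by rewrite /= big_nil.
rewrite /= big_cons {1}/fac; case: ifP => Hb; rewrite !hornerE /= ?add0n.
  rewrite add1n exprS; apply: ler_pM => //; rewrite ?exprn_ge0 //.
  by rewrite subr0 normrM norm_conjC (ger0_norm (ltW rho0)).
by rewrite ?mulr0 ?subr0 normr1 mul1r.
Qed.

(** If [2 ^+ i * x] is at least [2] from the index [i] on, then [4 ^- i] is
    comparable to [x ^+ 2]; this turns a sum of squares into dyadic counts. *)
Lemma sq_le_dyadic (K : numFieldType) (x : K) N :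
  0 <= x <= 1 -> 2 <= 2 ^+ N * x ->
  x ^+ 2 <= 16 * \sum_(i < N) (4 ^- i.+1) * (2 <= 2 ^+ i.+1 * x)%R%:R.
Proof.
have e4 : (2 : K) ^+ 2 = 4 by rewrite -natrX.
case/andP=> x0 x1; elim: N => [|N IHN] HN.
  by have := le_trans HN; rewrite expr0 mul1r => /(_ _ x1); rewrite (ler_nat _ 2 1).
rewrite big_ord_recr /= HN mulr1 mulrDr.
have s0 : 0 <= \sum_(i < N) (4 ^- i.+1) * (2 <= 2 ^+ i.+1 * x)%R%:R :> K.
  by rewrite sumr_ge0 // => i _; rewrite mulr_ge0 ?invr_ge0 ?exprn_ge0.
have [/IHN le_x|] := boolP (2 <= 2 ^+ N * x).
  by rewrite (le_trans le_x) // lerDl mulr_ge0 // invr_ge0 exprn_ge0.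
rewrite -real_ltNge ?realn ?ger0_real ?mulr_ge0 ?exprn_ge0 // => /ltW lt_x.
have -> : x ^+ 2 = 4 ^- N * (2 ^+ N * x) ^+ 2.
  rewrite exprMn -exprM mulnC exprM e4 mulrA mulVf ?mul1r //.
  by rewrite expf_neq0 // pnatr_eq0.
apply: (@le_trans _ _ (4 ^- N * 2 ^+ 2)).
  by rewrite ler_pM2l ?invr_gt0 ?exprn_gt0 // lerXn2r ?nnegrE ?mulr_ge0 ?exprn_ge0.
rewrite -[leLHS]add0r lerD ?mulr_ge0 // e4 exprS invfM mulrA mulrC.
by rewrite ler_pM2r ?invr_gt0 ?exprn_gt0 // ler_pdivlMr // -natrM ler_nat.
Qed.

(** With [x] the inverse modulus of a root, a number of roots that grows at
    most linearly with the radius, and no root of modulus less than [r], make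
    the sum of the [x ^+ 2] at most a constant times [1 / r]: by dyadic
    summation, the annulus of radius [2 ^ i * r] contributes a constant times
    [2 ^ i * r / (2 ^ i * r) ^ 2]. *)
Lemma sum_sq_le_of_count (K : numFieldType) (xs : seq K) (a r N : nat) :
  (0 < r)%N -> {in xs, forall x, 0 <= x /\ r%:R * x <= 1} ->
  {in xs, forall x, 2 <= 2 ^+ N * (r%:R * x)} ->
  (forall n, (0 < n)%N -> (count (fun x => 2 <= n%:R * x)%R xs <= a + n.*2)%N) ->
  r%:R ^+ 2 * (\sum_(x <- xs) x ^+ 2) <= 16 * (a + r.*2)%:R.
Proof.
move=> r0 xs01 HN Hcount.
have le1 : r%:R ^+ 2 * (\sum_(x <- xs) x ^+ 2) <=
    \sum_(x <- xs) 16 * \sum_(i < N) (4 ^- i.+1) * (2 <= 2 ^+ i.+1 * (r%:R * x))%R%:R.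
  rewrite mulr_sumr big_seq [leRHS]big_seq; apply: ler_sum => x xs_x.
  have [x0 x1] := xs01 x xs_x; rewrite -exprMn sq_le_dyadic ?HN //.
  by rewrite x1 mulr_ge0.
apply: le_trans le1 _; rewrite -mulr_sumr ler_pM2l // exchange_big /=.
apply: (@le_trans _ _ (\sum_(i < N) 2 ^- i.+1 * (a + r.*2)%:R)).
  apply: ler_sum => i _; rewrite -mulr_sumr.
  have -> : \sum_(x <- xs) (2 <= 2 ^+ i.+1 * (r%:R * x))%R%:R
      = (count (fun x : K => 2 <= (2 ^ i.+1 * r)%:R * x)%R xs)%:R :> K.
    elim: (xs) => [|x s IHs]; first by rewrite big_nil.
    by rewrite big_cons IHs /= natrD natrM natrX mulrA.
  apply: (@le_trans _ _ (4 ^- i.+1 * (a + (2 ^ i.+1 * r).*2)%:R)).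
    rewrite ler_pM2l ?invr_gt0 ?exprn_gt0 // ler_nat Hcount //.
    by rewrite muln_gt0 expn_gt0.
  have -> : 4 ^- i.+1 = 2 ^- i.+1 * 2 ^- i.+1 :> K.
    by rewrite -invfM -exprMn -natrM.
  rewrite -mulrA ler_pM2l ?invr_gt0 ?exprn_gt0 // mulrC.
  rewrite ler_pdivrMr ?exprn_gt0 // -natrX -natrM ler_nat mulnDl leq_add //.
    by rewrite -[leqLHS]muln1 leq_mul // expn_gt0.
  by rewrite -doubleMl mulnC.
rewrite -mulr_suml ger_pMl ?ltr0n ?addn_gt0 ?double_gt0 ?r0 ?orbT //.
suff -> : \sum_(i < N) 2 ^- i.+1 = 1 - 2 ^- N :> K.
  by rewrite gerBl invr_ge0 exprn_ge0.
elim: N {HN} => [|N IHN]; first by rewrite big_ord0 expr0 invr1 subrr.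
rewrite big_ord_recr /= IHN exprS.
have : (2 : K) ^+ N != 0 by rewrite expf_neq0 // pnatr_eq0.
by move=> H; field.
Qed.

(** Dividing by [1 - b X] multiplies the power series by the geometric series
    of ratio [b], whose coefficients have modulus at most [1]. *)
Lemma norm_coef_le_mul1B (K : numDomainType) (b : K) (u : {poly K}) m :
  `|b| <= 1 -> `|u`_m| <= \sum_(i < m.+1) `|((1 - b *: 'X) * u)`_i|.
Proof.
move=> b1; elim: m => [|m IHm].
  by rewrite big_ord1 mulrBl mul1r -scalerAl coefB coefZ coefXM mulr0 subr0.
rewrite big_ord_recr /=.
have -> : u`_m.+1 = b * u`_m + ((1 - b *: 'X) * u)`_m.+1.
  by rewrite mulrBl mul1r -scalerAl coefB coefZ coefXM /= addrC subrK.
apply: le_trans (ler_normD _ _) _; rewrite lerD2r normrM.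
by apply: le_trans IHm; rewrite ler_piMl.
Qed.

(** Since [1 / (1 - b X) = 1 + b X / (1 - b X)], the logarithmic derivative
    of the product is [- \sum b] minus [X] times [\sum b ^ 2 / (1 - b X)]; the
    polynomial [t] is [p] times the last sum. The bound carries an arbitrary
    factor [g] so that the induction can absorb the factor [1 - b X] that it
    adds to the product. *)
Lemma deriv_prod_remainder (K : numFieldType) (bs : seq K) :
  {in bs, forall b, `|b| <= 1} ->
  let p := \prod_(b <- bs) (1 - b *: 'X) in
  exists2 t : {poly K},
    p^`() = - (\sum_(b <- bs) b) *: p - 'X * t &
    forall g m, `|(t * g)`_m| <=
      (\sum_(i < m.+1) `|(p * g)`_i|) * \sum_(b <- bs) `|b| ^+ 2.
Proof.
elim: bs => [|b bs IHbs] bs1 /=.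
  exists 0; first by rewrite !big_nil oppr0 scale0r mulr0 subr0 -(derivC 1).
  by move=> g m; rewrite !big_nil mul0r coef0 normr0 mulr0.
have b1 : `|b| <= 1 by rewrite bs1 ?mem_head.
have [|t dq Ht] := IHbs; first by move=> x bs_x; rewrite bs1 // in_cons bs_x orbT.
rewrite !big_cons; set q := \prod_(b <- bs) _ in dq Ht *.
exists ((b ^+ 2) *: q + (1 - b *: 'X) * t).
  rewrite derivM derivB derivZ derivX -(polyC1 K) derivC dq.
  rewrite -!mul_polyC !rmorphN !rmorphD !rmorphXn /= polyC1; ring.
move=> g m; rewrite mulrDl coefD mulrDr; apply: le_trans (ler_normD _ _) _.
rewrite lerD //; last first.
  rewrite -[_ * t * g]mulrA [_ * (t * g)]mulrCA (le_trans (Ht _ m)) // ler_wpM2r ?sumr_ge0 // => [i _|].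
    by rewrite exprn_ge0.
  by rewrite le_eqVlt; apply/orP; left; apply/eqP; apply: eq_bigr => i _; rewrite mulrCA mulrA.
rewrite -scalerAl coefZ normrM normrX mulrC ler_wpM2r ?exprn_ge0 //.
by rewrite -mulrA norm_coef_le_mul1B.
Qed.

(** The coefficient of degree [m] in [p^`() - p`_1 *: p], which is the
    remainder above since [p`_1 = - \sum b]. The recurrence without remainder
    characterizes the exponential series. *)
Lemma coef_prod_recurrence (K : numFieldType) (bs : seq K) (p : {poly K}) m :
  {in bs, forall b, `|b| <= 1} -> p = \prod_(b <- bs) (1 - b *: 'X) ->
  `|p`_m.+1 *+ m.+1 - p`_1 * p`_m| <=
    (\sum_(i < m.+1) `|p`_i|) * \sum_(b <- bs) `|b| ^+ 2.
Proof.
move=> bs1 Dp; have [t] := deriv_prod_remainder bs1; rewrite -Dp => dp Ht.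
have p0 : p`_0 = 1.
  rewrite -horner_coef0 Dp horner_prod big1 // => b _.
  by rewrite !hornerE ?mulr0 ?subr0.
have dpm k : p`_k.+1 *+ k.+1 = - (\sum_(b <- bs) b) * p`_k - ('X * t)`_k.
  by rewrite -coef_deriv dp coefB coefZ.
have p1 : p`_1 = - \sum_(b <- bs) b.
  by have := dpm 0; rewrite coefXM p0 subr0 mulr1.
rewrite dpm p1 addrAC subrr add0r normrN coefXM.
have S0 : 0 <= \sum_(b <- bs) `|b| ^+ 2.
  by apply: sumr_ge0 => b _; rewrite exprn_ge0.
case: m => [|m] /=; first by rewrite normr0 mulr_ge0 // sumr_ge0.
rewrite -[t]mulr1 (le_trans (Ht _ _)) // mulr1 ler_wpM2r //.
by rewrite [leRHS]big_ord_recr lerDl.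
Qed.

Lemma prod_root_inverses (K : closedFieldType) (p : {poly K}) :
  p.[0] = 1 -> exists2 bs : seq K,
    p = \prod_(b <- bs) (1 - b *: 'X) & {in bs, forall b, b != 0 /\ p.[b^-1] = 0}.
Proof.
move=> p0; have pN0 : p != 0.
  by apply/eqP => p_0; move: p0; rewrite p_0 horner0 => /eqP; rewrite eq_sym oner_eq0.
have [rs Dp] := closed_field_poly_normal p.
have rsP : {in rs, forall r, root p r}.
  by move=> r rs_r; rewrite Dp rootZ ?lead_coef_eq0 // root_prod_XsubC.
have rsN0 : {in rs, forall r, r != 0}.
  move=> r rs_r; apply: contraTneq (rsP _ rs_r) => ->.
  by rewrite /root p0 oner_eq0.
exists [seq r^-1 | r <- rs]; last first.
  move=> _ /mapP[r rs_r ->]; rewrite invr_eq0 invrK rsN0 //; split=> //.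
  exact/eqP/rsP.
have Dprod : \prod_(r <- rs) ('X - r%:P) =
    (\prod_(r <- rs) - r) *: \prod_(b <- [seq r^-1 | r <- rs]) (1 - b *: 'X).
  elim: rs rsN0 {Dp rsP} => [|r rs IHrs] rsN0; first by rewrite !big_nil scale1r.
  have rN0 : r != 0 by rewrite rsN0 ?mem_head.
  rewrite /= !big_cons IHrs => [|x rs_x]; last by rewrite rsN0 // in_cons rs_x orbT.
  rewrite -scalerAr [- r * _]mulrC -scalerA [- r *: _]scalerAl; congr (_ *: (_ * _)).
  rewrite scalerBr scaleNr scaleNr scalerA mulfV // scale1r opprK.
  by rewrite alg_polyC addrC.
rewrite Dprod scalerA in Dp; rewrite {1}Dp -[RHS]scale1r; congr (_ *: _).
move: p0; rewrite {1}Dp hornerZ horner_prod.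
rewrite [X in _ * X]big1_seq ?mulr1 // => b _.
by rewrite !hornerE ?mulr0 ?subr0.
Qed.

(** A polynomial without zeros in the disc of radius [r], and of exponential
    growth, satisfies the recurrence of the coefficients of an exponential up
    to an error of order [1 / r]. The point is that the error does not depend
    on the degree, but only on the growth, the first coefficients and [r].
    The archimedean hypothesis on [K] guarantees that finitely many dyadic
    circles enclose all the roots. *)
Lemma zero_free_poly_recurrence (K : numClosedFieldType) (p : {poly K}) (a r m : nat) :
  (forall x : K, 0 < x -> exists N, 2 <= 2 ^+ N * x) ->
  (0 < r)%N -> p.[0] = 1 ->
  (forall z, `|z| <= r%:R -> p.[z] != 0) ->
  (forall z (n : nat), `|z| = n%:R -> `|p.[z]| <= 2 ^+ (a + n.*2)) ->
  r%:R ^+ 2 * `|p`_m.+1 *+ m.+1 - p`_1 * p`_m| <=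
    (\sum_(i < m.+1) `|p`_i|) * (16 * (a + r.*2)%:R).
Proof.
move=> archi r0 p0 pN0 Hp; have [bs Dp bsP] := prod_root_inverses p0.
have rR : 0 < r%:R :> K by rewrite ltr0n.
have bs_lt : {in bs, forall b, r%:R * `|b| <= 1}.
  move=> b /bsP[bN0 pb]; have b0 : 0 < `|b| by rewrite normr_gt0.
  rewrite -ler_pdivlMr // mul1r -normfV.
  have /orP[//|le_r] := real_leVge (realn K r) (normr_real b^-1).
  by have := pN0 _ le_r; rewrite pb eqxx.
have bs1 : {in bs, forall b, `|b| <= 1}.
  move=> b bs_b; apply: le_trans (bs_lt b bs_b).
  by rewrite ler_peMl // ler1n.
have [N HN] : exists N, {in [seq `|b| | b <- bs], forall x, 2 <= 2 ^+ N * (r%:R * x)}.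
  have : {in bs, forall b, b != 0} by move=> b /bsP[].
  elim: (bs) => [|b s IHs] sN0; first by exists 0.
  have [|N HN] := IHs; first by move=> x s_x; rewrite sN0 // in_cons s_x orbT.
  have [|N' HN'] := archi (r%:R * `|b|).
    by rewrite mulr_gt0 // normr_gt0 sN0 ?mem_head.
  exists (N + N') => x; rewrite /= in_cons => /orP[/eqP->|s_x].
    apply: le_trans HN' _; rewrite ler_wpM2r ?mulr_ge0 ?ler0n //.
    by rewrite -!natrX ler_nat leq_exp2l // leq_addl.
  apply: le_trans (HN x s_x) _; rewrite ler_wpM2r ?mulr_ge0 ?ler0n //.
    by case/mapP: s_x => y _ ->.
  by rewrite -!natrX ler_nat leq_exp2l // leq_addr.
have le_m := coef_prod_recurrence m bs1 Dp.
apply: le_trans (ler_wpM2l (exprn_ge0 2 (ltW rR)) le_m) _.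
rewrite mulrCA ler_wpM2l ?sumr_ge0 // -(big_map (fun b => `|b|) xpredT (fun x => x ^+ 2)).
apply: (sum_sq_le_of_count r0 _ HN) => [x /mapP[b bs_b ->]|n n0].
  by rewrite normr_ge0 bs_lt.
rewrite count_map -(@leq_exp2l 2) // -(ler_nat K) !natrX.
apply: (exp2_count_le (rho := n%:R)); first by rewrite ltr0n.
move=> z nz; apply: le_trans (Hp z n nz); rewrite Dp horner_prod.
rewrite le_eqVlt; apply/orP; left; apply/eqP; congr `|_|.
by apply: eq_bigr => b _; rewrite !hornerE.
Qed.

End ComplexPolynomials.

(** * Taylor polynomials without zeros in a disc *)

Open Scope R_scope.

Definition psum (c : nat -> C) (n : nat) (z : C) : C :=
  sum_n (fun k => Cmult (c k) (Cpow z k)) n.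

Module TaylorPolynomials.
Import all_boot all_order all_algebra complex Rstruct ComplexPolynomials.
Import Order.TTheory GRing.Theory Num.Theory.
Local Open Scope ring_scope.

(** A field isomorphism that carries [Cmod] to the norm; polynomials are
    factored over its codomain, and only estimates are carried back. *)
Definition toK (z : C) : complex R := Complex (fst z) (snd z).
Definition ofK (z : complex R) : C := let: Complex x y := z in (x, y).

Lemma ofKK z : toK (ofK z) = z. Proof. by case: z. Qed.
Lemma toK_inj z w : toK z = toK w -> z = w.
Proof. by case: z w => [x y] [x' y'] [-> ->]. Qed.
Lemma toKD z w : toK (Cplus z w) = toK z + toK w. Proof. by []. Qed.
Lemma toKB z w : toK (Cminus z w) = toK z - toK w. Proof. by []. Qed.
Lemma toKM z w : toK (Cmult z w) = toK z * toK w. Proof. by []. Qed.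
Lemma toKX z n : toK (Cpow z n) = toK z ^+ n.
Proof. by elim: n => //= n IHn; rewrite exprS -IHn. Qed.
Lemma toK_nat n : toK (RtoC (INR n)) = n%:R.
Proof. by rewrite INRE /toK /= -(rmorph_nat (real_complex R)). Qed.
Lemma norm_toK z : `|toK z| = real_complex R (Cmod z).
Proof. by rewrite normc_def /Cmod RsqrtE !RpowE. Qed.

Lemma ler_toK x y : (real_complex R x <= real_complex R y) <-> Rle x y.
Proof. by rewrite lecR; split => /RleP. Qed.

(** The estimate for polynomials without zeros, applied to a Taylor polynomial
    whose degree [n] exceeds [m], so that its coefficients up to [m + 1] are
    those of the series. *)
Lemma zero_free_psum_recurrence (c : nat -> C) (n m a r : nat) :
  c 0%N = RtoC 1 -> (0 < r)%coq_nat -> (m < n)%coq_nat ->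
  (forall z, Rle (Cmod z) (INR r) -> psum c n z <> RtoC 0) ->
  (forall z k, Cmod z = INR k ->
     Rle (Cmod (psum c n z)) (pow 2 (a + 2 * k))) ->
  Rle (Rmult (pow (INR r) 2)
    (Cmod (Cminus (Cmult (RtoC (INR m.+1)) (c m.+1)) (Cmult (c 1%N) (c m)))))
    (Rmult (sum_f_R0 (fun i => Cmod (c i)) m) (Rmult 16 (INR (a + 2 * r)))).
Proof.
move=> c0 /ssrnat.ltP r0 /ssrnat.ltP lt_mn psumN0 psum_le.
pose p : {poly complex R} := \poly_(i < n.+1) toK (c i).
have pE z : p.[toK z] = toK (psum c n z).
  rewrite horner_poly /psum; elim: (n) => [|k IHk].
    by rewrite big_ord1 sum_O toKM toKX.
  by rewrite big_ord_recr IHk /= sum_Sn -toKX -toKM -toKD.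
have pcoef i : (i <= n)%N -> p`_i = toK (c i) by move=> le_i; rewrite coef_poly ltnS le_i.
have p0 : p.[0] = 1 by rewrite horner_coef0 pcoef // c0.
have archi (x : complex R) : 0 < x -> exists N, 2 <= 2 ^+ N * x.
  case: x => x y; rewrite ltcE /= => /andP[/eqP y0 x0]; rewrite y0.
  have ltN := archi_boundP (divr_ge0 (ler0n R 2) (ltW x0)).
  exists (Num.bound (2 / x)).
  rewrite -(rmorph_nat (real_complex R) 2) -rmorphXn -(rmorphM (real_complex R)).
  rewrite lecR -ler_pdivrMr //; apply: ltW (lt_le_trans ltN _).
  by rewrite -natrX ler_nat ltnW // ltn_expl.
have := @zero_free_poly_recurrence _ p a r m archi r0 p0.
have H1 z : `|z| <= r%:R -> p.[z] != 0.
  rewrite -[z]ofKK norm_toK -toK_nat pE => /ler_toK /psumN0 zN0.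
  by apply/eqP => /(@toK_inj _ (RtoC 0)).
have H2 z (k : nat) : `|z| = k%:R -> `|p.[z]| <= 2 ^+ (a + k.*2).
  rewrite -[z]ofKK pE !norm_toK -toK_nat => -[/psum_le].
  rewrite -mul2n RpowE => /ler_toK; rewrite rmorphXn /=.
  by rewrite (rmorph_nat _ 2).
move=> /(_ H1 H2).
have -> : \sum_(i < m.+1) `|p`_i| = real_complex R (sum_f_R0 (fun i => Cmod (c i)) m).
  rewrite sum_f_R0E big_mkord rmorph_sum; apply: eq_bigr => i _.
  by rewrite pcoef ?norm_toK // -ltnS (leq_trans (ltn_ord i)) // ltnW.
rewrite !pcoef ?(ltnW lt_mn) ?(leq_trans _ lt_mn) //.
have -> : `|toK (c m.+1) *+ m.+1 - toK (c 1%N) * toK (c m)| = real_complex R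
    (Cmod (Cminus (Cmult (RtoC (INR m.+1)) (c m.+1)) (Cmult (c 1%N) (c m)))).
  by rewrite -norm_toK toKB !toKM toK_nat mulr_natl.
have natE k : k%:R = real_complex R (INR k) by rewrite INRE rmorph_nat.
rewrite !natE -rmorphXn -!(rmorphM (real_complex R)) -mul2n -RpowE => /ler_toK.
by rewrite (INR_IZR_INZ 16).
Qed.

End TaylorPolynomials.

(** * Power series of minimal exponential type *)

Definition shift (k : nat) (c : nat -> C) (n : nat) : C := c (k + n)%nat.

Definition is_Cseries (u : nat -> C) (l : C) : Prop :=
  @is_series C_AbsRing C_NormedModule u l.

Lemma is_Cseries_unique u l l' : is_Cseries u l -> is_Cseries u l' -> l = l'.
Proof.
intros H H'.
exact (filterlim_locally_unique (K := C_AbsRing) (V := C_NormedModule) (F := eventually) _ l l' H H').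
Qed.

(** Summing the real and imaginary parts separately gives a total sum. *)
Definition Csum (u : nat -> C) : C :=
  (Series (fun n => fst (u n)), Series (fun n => snd (u n))).

Lemma is_Cseries_Csum u l : is_Cseries u l -> Csum u = l.
Proof.
intros H.
assert (Hf : forall n, sum_n (fun k => fst (u k)) n = fst (sum_n (G := C_AbelianMonoid) u n) /\
   sum_n (fun k => snd (u k)) n = snd (sum_n (G := C_AbelianMonoid) u n)).
{ induction n as [|n [IH1 IH2]]; [now rewrite !sum_O|].
  now rewrite !sum_Sn, IH1, IH2. }
destruct l as [x y]; unfold Csum; f_equal; apply is_series_unique.
- apply filterlim_ext with (fun n => fst (sum_n (G := C_AbelianMonoid) u n)); [intro n; symmetry; apply Hf|].
  apply (filterlim_comp _ _ _ _ (fun z : C => fst z) _ _ _ H).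
  apply (continuous_fst (U := R_UniformSpace) (V := R_UniformSpace) x y).
- apply filterlim_ext with (fun n => snd (sum_n (G := C_AbelianMonoid) u n)); [intro n; symmetry; apply Hf|].
  apply (filterlim_comp _ _ _ _ (fun z : C => snd z) _ _ _ H).
  apply (continuous_snd (U := R_UniformSpace) (V := R_UniformSpace) x y).
Qed.

Lemma Csum_dominated u v s :
  (forall n, Cmod (u n) <= v n) -> is_series v s ->
  is_Cseries u (Csum u) /\ Cmod (Csum u) <= s.
Proof.
intros Huv Hs.
assert (Hex : @ex_series C_AbsRing C_NormedModule u).
{ apply (ex_series_le (K := C_AbsRing) (V := C_CompleteNormedModule) u v); [exact Huv | now exists s]. }
destruct Hex as [l Hl].
rewrite (is_Cseries_Csum u l Hl); split; [exact Hl|].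
assert (Hn : is_lim_seq (fun n => Cmod (sum_n (G := C_AbelianMonoid) u n)) (Cmod l)).
{ apply (filterlim_comp _ _ _ _ Cmod _ _ _ Hl).
  apply (filterlim_norm (K := C_AbsRing) (V := C_NormedModule)). }
refine (is_lim_seq_le _ _ (Cmod l) s _ Hn Hs).
intro n; apply Rle_trans with (sum_n (fun k => Cmod (u k)) n).
- apply (norm_sum_n_m (K := C_AbsRing) (V := C_NormedModule)).
- apply sum_n_m_le; exact Huv.
Qed.

Lemma exp_le_exp x y : x <= y -> exp x <= exp y.
Proof. intros [H | ->]; [left; now apply exp_increasing | apply Rle_refl]. Qed.

Definition eval (c : nat -> C) (z : C) : C := Csum (fun n => c n * z ^ n)%C.

(** The weight makes [M * exp (e * Cmod z)] the dominating series, so that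
    [e] bounds the exponential type of the sum. *)
Definition has_bound (M e : R) (c : nat -> C) : Prop :=
  forall n, Cmod (c n) <= M * (e ^ n / INR (fact n)).

Definition minimal_type (c : nat -> C) : Prop :=
  forall e, 0 < e -> exists M, has_bound M e c.

Lemma has_bound_ge0 M e c : has_bound M e c -> 0 <= M.
Proof.
intros H; specialize (H 0%nat); simpl in H.
pose proof (Cmod_ge_0 (c 0%nat)); lra.
Qed.

Lemma is_series_exp x : is_series (fun n => x ^ n / INR (fact n)) (exp x).
Proof.
apply is_series_ext with (fun n => / INR (fact n) * x ^ n); [intro n; apply Rmult_comm|].
apply is_pseries_R, is_exp_Reals.
Qed.

Lemma eval_has_bound M e c z :
  has_bound M e c ->
  is_Cseries (fun n => c n * z ^ n)%C (eval c z) /\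
  Cmod (eval c z) <= M * exp (e * Cmod z).
Proof.
intros H; apply Csum_dominated with (fun n => M * ((e * Cmod z) ^ n / INR (fact n))).
- intro n; rewrite Cmod_mult, Cmod_pow, Rpow_mult_distr.
  replace (M * (e ^ n * Cmod z ^ n / INR (fact n)))
    with (M * (e ^ n / INR (fact n)) * Cmod z ^ n) by (field; apply INR_fact_neq_0).
  apply Rmult_le_compat_r; [apply pow_le, Cmod_ge_0 | apply H].
- apply (is_series_scal (K := R_AbsRing) (V := R_NormedModule) M), is_series_exp.
Qed.

Lemma eval_minimal_type c z :
  minimal_type c -> is_Cseries (fun n => c n * z ^ n)%C (eval c z).
Proof.
intros H; destruct (H 1 Rlt_0_1) as [M HM].
apply (eval_has_bound M 1 c z HM).
Qed.

Lemma fact_mul_le n k : INR (fact n) * INR (fact k) <= INR (fact (n + k)).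
Proof.
rewrite <- mult_INR; apply le_INR.
induction n as [|n IHn]; simpl; [lia|].
pose proof (Factorial.fact_neq_0 n); nia.
Qed.

Lemma has_bound_shift M e c k :
  0 <= e -> has_bound M e c -> has_bound (M * e ^ k / INR (fact k)) e (shift k c).
Proof.
intros He H n; unfold shift; eapply Rle_trans; [apply H|].
pose proof (has_bound_ge0 _ _ _ H).
rewrite pow_add.
replace (M * e ^ k / INR (fact k) * (e ^ n / INR (fact n)))
  with (M * (e ^ k * e ^ n / (INR (fact k) * INR (fact n))))
  by (field; split; apply INR_fact_neq_0).
apply Rmult_le_compat_l; [assumption|].
apply Rmult_le_compat_l; [apply Rmult_le_pos; apply pow_le; assumption|].
apply Rinv_le_contravar; [apply Rmult_lt_0_compat; apply INR_fact_lt_0|].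
apply fact_mul_le.
Qed.

Lemma minimal_type_shift c k : minimal_type c -> minimal_type (shift k c).
Proof.
intros H e He; destruct (H e He) as [M HM].
eexists; apply has_bound_shift; [lra | exact HM].
Qed.

Lemma eval_decr_1 c z :
  minimal_type c -> eval c z = (c 0%nat + z * eval (shift 1 c) z)%C.
Proof.
intros H; apply (is_Cseries_unique (fun n => c n * z ^ n)%C).
{ now apply eval_minimal_type. }
apply (is_series_decr_1 (K := C_AbsRing) (V := C_NormedModule)).
apply (is_series_ext (K := C_AbsRing) (V := C_NormedModule) (fun n => scal z (shift 1 c n * z ^ n)%C)).
{ intro n; change (z * (shift 1 c n * z ^ n) = c (S n) * z ^ (S n))%C; unfold shift; simpl; ring. }
replace (plus _ _) with (scal (V := C_NormedModule) z (eval (shift 1 c) z)).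
2:{ change (z * eval (shift 1 c) z = (c 0%nat + z * eval (shift 1 c) z) + - (c 0%nat * z ^ 0))%C; simpl; ring. }
apply (is_series_scal (K := C_AbsRing) (V := C_NormedModule)).
now apply eval_minimal_type, minimal_type_shift.
Qed.

Lemma eval_split c n z :
  minimal_type c ->
  eval c z = (psum c n z + z ^ (S n) * eval (shift (S n) c) z)%C.
Proof.
intros H; induction n as [|n IHn].
- unfold psum; rewrite sum_O, eval_decr_1 by assumption; simpl; ring.
- rewrite IHn; unfold psum; rewrite sum_Sn; change plus with Cplus.
  rewrite (eval_decr_1 (shift (S n) c)) by now apply minimal_type_shift.
  unfold shift at 1; rewrite Nat.add_0_r.
  replace (eval (shift 1 (shift (S n) c)) z) with (eval (shift (S (S n)) c) z).
  + simpl; ring.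
  + unfold eval; f_equal; apply functional_extensionality; intro k.
    unfold shift; do 2 f_equal; lia.
Qed.

(** * Division by z - a *)

(** The coefficients of [(eval c z - eval c a) / (z - a)], obtained by
    expanding [1 / (z - a)] in powers of [a / z]. *)
Definition quotient (a : C) (c : nat -> C) (n : nat) : C := eval (shift (S n) c) a.

Lemma has_bound_quotient M e c a :
  0 <= e -> has_bound M e c ->
  has_bound (M * (e * exp (e * Cmod a))) e (quotient a c).
Proof.
intros He H n; unfold quotient.
destruct (eval_has_bound _ _ _ a (has_bound_shift M e c (S n) He H)) as [_ Hle].
eapply Rle_trans; [exact Hle|].
replace (M * (e * exp (e * Cmod a)) * (e ^ n / INR (fact n)))
  with (M * e ^ S n / INR (fact n) * exp (e * Cmod a))
  by (simpl; field; apply INR_fact_neq_0).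
apply Rmult_le_compat_r; [left; apply exp_pos|].
apply Rmult_le_compat_l.
{ apply Rmult_le_pos; [exact (has_bound_ge0 _ _ _ H) | now apply pow_le]. }
apply Rinv_le_contravar; [apply INR_fact_lt_0 | apply le_INR, fact_le; lia].
Qed.

Lemma minimal_type_quotient a c : minimal_type c -> minimal_type (quotient a c).
Proof.
intros H e He; destruct (H e He) as [M HM].
eexists; apply has_bound_quotient; [lra | exact HM].
Qed.

Lemma shift_shift j k c : shift j (shift k c) = shift (k + j) c.
Proof.
apply functional_extensionality; intro n; unfold shift; f_equal; lia.
Qed.

Lemma coef_quotient a c n :
  minimal_type c -> c (S n) = (quotient a c n - a * quotient a c (S n))%C.
Proof.
intros H; unfold quotient.
rewrite (eval_decr_1 (shift (S n) c)) by now apply minimal_type_shift.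
rewrite shift_shift; unfold shift at 1.
replace (S n + 1)%nat with (S (S n)) by lia; rewrite Nat.add_0_r; ring.
Qed.

(** The one identity behind continuity, complex differentiability and the
    removal of zeros: the quotient is again a power series of minimal type. *)
Lemma eval_quotient a c z :
  minimal_type c -> eval c z = (eval c a + (z - a) * eval (quotient a c) z)%C.
Proof.
intros H; pose proof (minimal_type_quotient a c H) as Hq.
rewrite (eval_decr_1 c z H), (eval_decr_1 c a H).
change (eval (shift 1 c) a) with (quotient a c 0).
assert (Hs : eval (shift 1 c) z =
  (eval (quotient a c) z - a * eval (shift 1 (quotient a c)) z)%C).
{ apply (is_Cseries_unique (fun n => shift 1 c n * z ^ n)%C).
  { now apply eval_minimal_type, minimal_type_shift. }
  apply (is_series_ext (K := C_AbsRing) (V := C_NormedModule)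
    (fun n => plus (quotient a c n * z ^ n)%C
       (scal (- a)%C (shift 1 (quotient a c) n * z ^ n)%C))).
  { intro n.
    change (quotient a c n * z ^ n + - a * (quotient a c (S n) * z ^ n)
      = c (S n) * z ^ n)%C.
    rewrite (coef_quotient a c n H); ring. }
  replace (_ - _)%C with (plus (eval (quotient a c) z)
    (scal (V := C_NormedModule) (- a)%C (eval (shift 1 (quotient a c)) z))).
  2:{ change (eval (quotient a c) z + - a * eval (shift 1 (quotient a c)) z =
        eval (quotient a c) z - a * eval (shift 1 (quotient a c)) z)%C; ring. }
  apply (is_series_plus (K := C_AbsRing) (V := C_NormedModule)).
  - now apply eval_minimal_type.
  - apply (is_series_scal (K := C_AbsRing) (V := C_NormedModule)).
    now apply eval_minimal_type, minimal_type_shift. }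
rewrite Hs, (eval_decr_1 (quotient a c) z Hq); ring.
Qed.

Lemma eval_loc_bounded c a :
  minimal_type c -> exists B, 0 < B /\ forall z, Cmod (z - a) <= 1 -> Cmod (eval c z) <= B.
Proof.
intros H; destruct (H 1 Rlt_0_1) as [M HM].
exists ((M + 1) * exp (Cmod a + 1)).
pose proof (has_bound_ge0 _ _ _ HM).
split; [apply Rmult_lt_0_compat; [lra | apply exp_pos]|].
intros z Hz; destruct (eval_has_bound M 1 c z HM) as [_ Hle].
eapply Rle_trans; [exact Hle|].
apply Rmult_le_compat; [lra | left; apply exp_pos | lra |].
apply exp_le_exp.
replace z with (a + (z - a))%C by ring.
pose proof (Cmod_triangle a (z - a)); lra.
Qed.

Lemma eval_lipschitz c a :
  minimal_type c ->
  exists B, 0 < B /\ forall z, Cmod (z - a) <= 1 ->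
    Cmod (eval c z - eval c a) <= Cmod (z - a) * B.
Proof.
intros H.
destruct (eval_loc_bounded (quotient a c) a (minimal_type_quotient a c H)) as [B [HB Hle]].
exists B; split; [exact HB|]; intros z Hz.
rewrite (eval_quotient a c z H).
replace (_ - _)%C with ((z - a) * eval (quotient a c) z)%C by ring.
rewrite Cmod_mult; apply Rmult_le_compat_l; [apply Cmod_ge_0 | auto].
Qed.

(** The derivative at [a] is the value at [a] of the quotient series, and the
    error term is controlled by the Lipschitz bound for that series. *)
Lemma entire_eval c : minimal_type c -> entire (eval c).
Proof.
intros H a; exists (eval (quotient a c) a); split.
{ apply is_linear_scal_l. }
intros x Hx.
apply (is_filter_lim_locally_unique (K := C_AbsRing) (V := AbsRing_NormedModule C_AbsRing)) in Hx.
subst x.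
intros [e He]; simpl.
destruct (eval_lipschitz (quotient a c) a (minimal_type_quotient a c H)) as [B [HB Hle]].
assert (Hd : 0 < Rmin 1 (e / B)).
{ apply Rmin_pos; [lra | now apply Rdiv_lt_0_compat]. }
apply (locally_le_locally_norm (K := C_AbsRing) (V := AbsRing_NormedModule C_AbsRing)).
exists (mkposreal _ Hd); intros z Hz.
change (Cmod (z - a) < Rmin 1 (e / B)) in Hz.
pose proof (Rmin_l 1 (e / B)); pose proof (Rmin_r 1 (e / B)).
change (Cmod ((eval c z - eval c a) - (z - a) * eval (quotient a c) a)
  <= e * Cmod (z - a)).
rewrite (eval_quotient a c z H).
replace (_ - _ - _)%C with ((z - a) * (eval (quotient a c) z - eval (quotient a c) a))%C by ring.
rewrite Cmod_mult, Rmult_comm.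
apply Rmult_le_compat_r; [apply Cmod_ge_0|].
eapply Rle_trans; [apply Hle; lra|].
apply Rle_trans with (e / B * B); [apply Rmult_le_compat_r; lra | right; field; lra].
Qed.

Lemma coef_le_quotient a c D :
  minimal_type c -> eval c a = RtoC 0 ->
  (forall n, Cmod (quotient a c n) <= D) ->
  forall n, Cmod (c n) <= D * (1 + Cmod a).
Proof.
intros H Ha HD.
assert (HaD : forall n, Cmod (a * quotient a c n) <= Cmod a * D).
{ intro n; rewrite Cmod_mult; apply Rmult_le_compat_l; [apply Cmod_ge_0 | apply HD]. }
intros [|n].
- rewrite (eval_decr_1 c a H) in Ha; change (eval (shift 1 c) a) with (quotient a c 0) in Ha.
  replace (c 0%nat) with (- (a * quotient a c 0))%C.
  2:{ replace (c 0%nat) with ((c 0%nat + a * quotient a c 0) - a * quotient a c 0)%C by ring.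
      rewrite Ha; ring. }
  rewrite Cmod_opp; specialize (HaD 0%nat); specialize (HD 0%nat).
  pose proof (Cmod_ge_0 (quotient a c 0)); lra.
- rewrite (coef_quotient a c n H); unfold Cminus.
  eapply Rle_trans; [apply Cmod_triangle|]; rewrite Cmod_opp.
  specialize (HaD (S n)); specialize (HD n); lra.
Qed.

Lemma minimal_type_iter_quotient a m c :
  minimal_type c -> minimal_type (Nat.iter m (quotient a) c).
Proof.
intros H; induction m as [|m IHm]; [exact H | now apply minimal_type_quotient].
Qed.

(** Dividing by [z - a] multiplies the bound on the coefficients by a factor
    that is as small as wished with [e], while multiplying back costs at most
    [1 + Cmod a]. If division without remainder can go on for ever, the
    coefficients are therefore at most [M * (1 / 2) ^ m] for every [m]. *)
Lemma zero_of_infinite_order a c :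
  minimal_type c ->
  (forall m, eval (Nat.iter m (quotient a) c) a = RtoC 0) ->
  forall n, c n = RtoC 0.
Proof.
intros H Hz.
(* This choice gives [e * exp (e * Cmod a) * (1 + Cmod a) <= 3 / 8]. *)
pose (e := / (8 * (1 + Cmod a))).
pose proof (Cmod_ge_0 a) as Ha0.
assert (He : 0 < e) by (apply Rinv_0_lt_compat; lra).
assert (Hea : e * (1 + Cmod a) = / 8) by (unfold e; field; lra).
assert (He1 : e <= 1) by nra.
pose (q := e * exp (e * Cmod a)).
assert (Hq : 0 <= q * (1 + Cmod a) <= / 2).
{ unfold q; pose proof exp_le_3; pose proof (exp_pos (e * Cmod a)).
  assert (exp (e * Cmod a) <= exp 1) by (apply exp_le_exp; nra).
  replace (e * exp (e * Cmod a) * (1 + Cmod a)) with (/ 8 * exp (e * Cmod a)).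
  2:{ rewrite <- Hea; ring. }
  lra. }
destruct (H e He) as [M HM].
assert (Hb : forall m, has_bound (M * q ^ m) e (Nat.iter m (quotient a) c)).
{ induction m as [|m IHm]; [simpl; now rewrite Rmult_1_r|].
  replace (M * q ^ S m) with (M * q ^ m * (e * exp (e * Cmod a))) by (simpl; unfold q; ring).
  apply has_bound_quotient; [lra | exact IHm]. }
pose proof (has_bound_ge0 _ _ _ HM) as HM0.
assert (Hle : forall m n, Cmod (c n) <= M * q ^ m * (1 + Cmod a) ^ m).
{ intros m.
  assert (Hj : forall j, (j <= m)%nat -> forall n,
    Cmod (Nat.iter (m - j) (quotient a) c n) <= M * q ^ m * (1 + Cmod a) ^ j).
  { induction j as [|j IHj]; intros Hjm n.
    - rewrite Nat.sub_0_r, pow_O, Rmult_1_r.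
      eapply Rle_trans; [apply Hb|].
      rewrite <- (Rmult_1_r (M * q ^ m)) at 2.
      apply Rmult_le_compat_l; [exact (has_bound_ge0 _ _ _ (Hb m))|].
      apply Rle_div_l; [apply INR_fact_lt_0|].
      rewrite Rmult_1_l; apply Rle_trans with 1.
      + rewrite <- (pow1 n); apply pow_incr; lra.
      + apply (le_INR 1), lt_O_fact.
    - replace (M * q ^ m * (1 + Cmod a) ^ S j)
        with (M * q ^ m * (1 + Cmod a) ^ j * (1 + Cmod a)) by (simpl; ring).
      apply coef_le_quotient; [now apply minimal_type_iter_quotient | apply Hz |].
      intro k; change (quotient a (Nat.iter (m - S j) (quotient a) c))
        with (Nat.iter (S (m - S j)) (quotient a) c).
      replace (S (m - S j)) with (m - j)%nat by lia; apply IHj; lia. }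
  intro n; specialize (Hj m (le_n m) n); now rewrite Nat.sub_diag in Hj. }
intro n; apply Cmod_eq_0; apply Rle_antisym; [|apply Cmod_ge_0].
apply Rnot_lt_le; intro Hpos.
destruct (pow_lt_1_zero (/ 2)) with (y := Cmod (c n) / (M + 1)) as [N HN].
{ rewrite Rabs_pos_eq; lra. }
{ apply Rdiv_lt_0_compat; lra. }
specialize (HN N (le_n N)).
rewrite Rabs_pos_eq in HN by (apply pow_le; lra).
apply Rlt_div_r in HN; [|lra].
specialize (Hle N n); rewrite Rmult_assoc, <- Rpow_mult_distr in Hle.
assert ((q * (1 + Cmod a)) ^ N <= (/ 2) ^ N) by (apply pow_incr; lra).
assert (0 <= (/ 2) ^ N) by (apply pow_le; lra).
nra.
Qed.

(** * Series without zeros *)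
Lemma Cmod_le_abs x y : Cmod (x, y) <= Rabs x + Rabs y.
Proof.
replace (x, y) with (RtoC x + RtoC y * Ci)%C.
2:{ apply injective_projections; simpl; ring. }
eapply Rle_trans; [apply Cmod_triangle|].
rewrite Cmod_mult, Cmod_Ci, !Cmod_R; lra.
Qed.

(** The sum is continuous and does not vanish, and a square that contains the
    disc is compact. *)
Lemma eval_lower_bound c r :
  minimal_type c -> (forall z, eval c z <> RtoC 0) ->
  exists d, 0 < d /\ forall z, Cmod z <= r -> d <= Cmod (eval c z).
Proof.
intros H Hnz.
assert (Hloc : forall w : C, exists d : posreal, forall z : C,
  Rabs (fst z - fst w) < d -> Rabs (snd z - snd w) < d -> d <= Cmod (eval c z)).
{ intro w; destruct (eval_lipschitz c w H) as [B [HB Hle]].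
  set (v := Cmod (eval c w)).
  assert (Hv : 0 < v) by (apply Cmod_gt_0, Hnz).
  assert (Hd : 0 < Rmin (/ 2) (Rmin (v / 2) (v / (4 * B)))).
  { repeat apply Rmin_pos; try lra; apply Rdiv_lt_0_compat; lra. }
  exists (mkposreal _ Hd); simpl; intros z Hx Hy.
  set (d := Rmin (/ 2) _) in *.
  assert (d <= / 2) by apply Rmin_l.
  assert (d <= v / 2) by (eapply Rle_trans; [apply Rmin_r | apply Rmin_l]).
  assert (d <= v / (4 * B)) by (eapply Rle_trans; [apply Rmin_r | apply Rmin_r]).
  assert (Hzw : Cmod (z - w) <= 2 * d).
  { eapply Rle_trans; [exact (Cmod_le_abs (fst z - fst w) (snd z - snd w))|lra]. }
  assert (Hzv : Cmod (z - w) * B <= v / 2).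
  { apply Rle_trans with (2 * (v / (4 * B)) * B); [apply Rmult_le_compat_r; lra|].
    right; field; lra. }
  specialize (Hle z ltac:(lra)).
  assert (v <= Cmod (eval c z) + Cmod (eval c z - eval c w)); [|lra].
  unfold v; replace (eval c w) with (eval c z + - (eval c z - eval c w))%C at 1 by ring.
  eapply Rle_trans; [apply Cmod_triangle|]; rewrite Cmod_opp; lra. }
destruct (choice _ Hloc) as [delta Hdelta].
destruct (compactness_value_2d (- r) r (- r) r (fun u v => delta (u, v))) as [d Hd].
exists d; split; [apply cond_pos|]; intros z Hz.
pose proof (Rmax_Cmod z) as Hmax.
assert (Hx : Rabs (fst z) <= r) by (eapply Rle_trans; [apply Rmax_l | eapply Rle_trans; eassumption]).
assert (Hy : Rabs (snd z) <= r) by (eapply Rle_trans; [apply Rmax_r | eapply Rle_trans; eassumption]).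
apply Rabs_le_between in Hx; apply Rabs_le_between in Hy.
apply Rnot_lt_le; intro Hlt; apply (Hd (fst z) (snd z) Hx Hy).
intros (u & v & _ & _ & Hu & Hv & Hle).
pose proof (Hdelta (u, v) z Hu Hv); simpl in *; lra.
Qed.

(** The Taylor polynomials converge uniformly on the disc, where the modulus
    of the sum is bounded below. *)
Lemma psum_zero_free c r m :
  minimal_type c -> (forall z, eval c z <> RtoC 0) -> 0 < r ->
  exists n, (m < n)%nat /\ forall z, Cmod z <= r -> psum c n z <> RtoC 0.
Proof.
intros H Hnz Hr.
destruct (eval_lower_bound c r H Hnz) as [d [Hd Hle]].
assert (He : 0 < / (2 * r)) by (apply Rinv_0_lt_compat; lra).
destruct (H _ He) as [M HM]; pose proof (has_bound_ge0 _ _ _ HM) as HM0.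
destruct (pow_lt_1_zero (/ 2)) with (y := d / (3 * (M + 1))) as [N HN].
{ rewrite Rabs_pos_eq; lra. }
{ apply Rdiv_lt_0_compat; lra. }
set (n := (N + S m)%nat).
exists n; split; [unfold n; lia|]; intros z Hz Hpz.
specialize (HN (S n) ltac:(unfold n; lia)).
rewrite Rabs_pos_eq in HN by (apply pow_le; lra).
specialize (Hle z Hz).
rewrite (eval_split c n z H), Hpz, Cplus_0_l, Cmod_mult, Cmod_pow in Hle.
destruct (eval_has_bound _ _ _ z (has_bound_shift M _ c (S n) (Rlt_le _ _ He) HM)) as [_ Hs].
pose proof (Cmod_ge_0 z) as Hz0.
assert (Hexp : exp (/ (2 * r) * Cmod z) <= 3).
{ apply Rle_trans with (exp 1); [apply exp_le_exp | apply exp_le_3].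
  apply Rmult_le_reg_l with (2 * r); [lra|].
  rewrite <- Rmult_assoc, Rinv_r by lra; lra. }
assert (Hf : 1 <= INR (fact (S n))) by (apply (le_INR 1), lt_O_fact).
assert (Hs' : Cmod (eval (shift (S n) c) z) <= M * (/ (2 * r)) ^ S n * 3).
{ eapply Rle_trans; [exact Hs|].
  assert (0 <= M * (/ (2 * r)) ^ S n) by (apply Rmult_le_pos; [lra | apply pow_le; lra]).
  apply Rmult_le_compat; [| left; apply exp_pos | | exact Hexp].
  - apply Rdiv_le_0_compat; lra.
  - apply Rle_div_l; nra. }
assert (Cmod z ^ S n * Cmod (eval (shift (S n) c) z) <= r ^ S n * (M * (/ (2 * r)) ^ S n * 3)).
{ apply Rmult_le_compat; [apply pow_le; lra | apply Cmod_ge_0 | apply pow_incr; lra | exact Hs']. }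
replace (r ^ S n * (M * (/ (2 * r)) ^ S n * 3)) with (M * 3 * (/ 2) ^ S n) in *.
2:{ replace (/ 2) with (r * / (2 * r)) by (field; lra).
    rewrite Rpow_mult_distr; ring. }
apply Rlt_div_r in HN; [|lra].
assert (0 <= (/ 2) ^ S n) by (apply pow_le; lra).
nra.
Qed.

Lemma psum_le_exp M c n z :
  has_bound M 1 c -> Cmod (psum c n z) <= M * exp (Cmod z).
Proof.
intro H; pose proof (has_bound_ge0 _ _ _ H) as HM.
apply Rle_trans with (sum_n (fun k => M * (Cmod z ^ k / INR (fact k))) n).
- eapply Rle_trans; [apply (norm_sum_n_m (K := C_AbsRing) (V := C_NormedModule))|].
  apply sum_n_m_le; intro k; change norm with Cmod; cbv beta; rewrite Cmod_mult, Cmod_pow.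
  specialize (H k); rewrite pow1 in H.
  replace (M * (Cmod z ^ k / INR (fact k))) with (M * (1 / INR (fact k)) * Cmod z ^ k)
    by (field; apply INR_fact_neq_0).
  apply Rmult_le_compat_r; [apply pow_le, Cmod_ge_0 | exact H].
- assert (Hs : is_series (fun k => M * (Cmod z ^ k / INR (fact k))) (M * exp (Cmod z))).
  { apply (is_series_scal (K := R_AbsRing) (V := R_NormedModule) M), is_series_exp. }
  apply (is_lim_seq_incr_compare _ _ Hs).
  intro k; rewrite sum_Sn; change plus with Rplus.
  assert (0 <= M * (Cmod z ^ S k / INR (fact (S k)))); [|simpl in *; lra].
  apply Rmult_le_pos; [lra|]; apply Rdiv_le_0_compat; [apply pow_le, Cmod_ge_0 | apply INR_fact_lt_0].
Qed.

Lemma exp_INR_le k : exp (INR k) <= 4 ^ k.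
Proof.
induction k as [|k IHk]; [simpl; rewrite exp_0; lra|].
rewrite S_INR, exp_plus; change (4 ^ S k) with (4 * 4 ^ k); pose proof exp_le_3.
pose proof (exp_pos (INR k)); pose proof (exp_pos 1); nra.
Qed.

Lemma le_pow2 M : exists a, M <= 2 ^ a.
Proof.
destruct (Pow_x_infinity 2) with (b := M) as [N HN]; [rewrite Rabs_pos_eq; lra|].
exists N; specialize (HN N (le_n N)).
rewrite Rabs_pos_eq in HN by (apply pow_le; lra); lra.
Qed.

(** Taylor polynomials of large degree have no zeros in the disc of radius
    [r], so the recurrence holds up to an error of order [1 / r], for every
    [r]. *)
Lemma zero_free_recurrence c m :
  minimal_type c -> (forall z, eval c z <> RtoC 0) -> c 0%nat = RtoC 1 ->
  (RtoC (INR (S m)) * c (S m) = c 1%nat * c m)%C.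
Proof.
intros H Hnz Hc0.
destruct (H 1 Rlt_0_1) as [M HM]; pose proof (has_bound_ge0 _ _ _ HM) as HM0.
destruct (le_pow2 M) as [a Ha].
set (X := Cmod (RtoC (INR (S m)) * c (S m) - c 1%nat * c m)%C).
set (s := sum_f_R0 (fun i => Cmod (c i)) m).
assert (Hs : 0 <= s) by (apply cond_pos_sum; intro; apply Cmod_ge_0).
assert (Hr : forall r, (0 < r)%nat -> INR r * X <= s * 16 * (INR a + 2)).
{ intros r Hr; assert (HrR : 1 <= INR r) by (apply (le_INR 1); lia).
  destruct (psum_zero_free c (INR r) m H Hnz ltac:(lra)) as [n [Hmn Hn]].
  assert (HX := TaylorPolynomials.zero_free_psum_recurrence c n m a r Hc0 Hr Hmn Hn).
  fold X s in HX.
  apply Rmult_le_reg_l with (INR r); [lra|].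
  replace (INR r * (INR r * X)) with (INR r ^ 2 * X) by ring.
  eapply Rle_trans; [apply HX|].
  - intros z k Hz; eapply Rle_trans; [apply (psum_le_exp M c n z HM)|].
    rewrite Hz, pow_add, pow_mult.
    apply Rmult_le_compat; [lra | left; apply exp_pos | exact Ha |].
    replace (2 ^ 2) with 4 by ring; apply exp_INR_le.
  - rewrite plus_INR, mult_INR; simpl (INR 2).
    replace (INR r * (s * 16 * (INR a + 2))) with (s * (16 * (INR r * INR a + 2 * INR r))) by ring.
    apply Rmult_le_compat_l; [exact Hs|].
    pose proof (pos_INR a); nra. }
assert (HX0 : X = 0).
{ apply Rle_antisym; [|apply Cmod_ge_0]; apply Rnot_lt_le; intro HX.
  destruct (INR_unbounded (s * 16 * (INR a + 2) / X)) as [r Hr'].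
  apply Rlt_div_l in Hr'; [|exact HX].
  specialize (Hr (S r) ltac:(lia)); rewrite S_INR in Hr; nra. }
apply Cmod_eq_0 in HX0.
replace (RtoC (INR (S m)) * c (S m))%C
  with ((RtoC (INR (S m)) * c (S m) - c 1%nat * c m) + c 1%nat * c m)%C by ring.
rewrite HX0; ring.
Qed.

(** By the recurrence the sum is [exp (c 1 * z)], and this exponential has
    minimal type only if [c 1] vanishes. *)
Lemma zero_free_constant_normalized c n :
  minimal_type c -> (forall z, eval c z <> RtoC 0) -> c 0%nat = RtoC 1 ->
  c (S n) = RtoC 0.
Proof.
intros H Hnz Hc0.
assert (Hc : forall m, (RtoC (INR (fact m)) * c m = c 1%nat ^ m)%C).
{ induction m as [|m IHm].
  - rewrite Hc0; simpl; ring.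
  - rewrite fact_simpl, mult_INR, RtoC_mult.
    replace (RtoC (INR (S m)) * RtoC (INR (fact m)) * c (S m))%C
      with (RtoC (INR (fact m)) * (RtoC (INR (S m)) * c (S m)))%C by ring.
    rewrite (zero_free_recurrence c m H Hnz Hc0), Cpow_S, <- IHm; ring. }
assert (Hc1 : c 1%nat = RtoC 0).
{ apply NNPP; intro Hne; apply Cmod_gt_0 in Hne.
  destruct (H (Cmod (c 1%nat) / 2) ltac:(lra)) as [M HM].
  destruct (le_pow2 (M + 1)) as [a Ha].
  specialize (HM a).
  assert (Hma : INR (fact a) * Cmod (c a) = Cmod (c 1%nat) ^ a).
  { rewrite <- Cmod_pow, <- Hc, Cmod_mult, Cmod_R, Rabs_pos_eq by apply pos_INR; ring. }
  assert (Hp : 0 < Cmod (c 1%nat) ^ a) by now apply pow_lt.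
  assert (Hle : Cmod (c 1%nat) ^ a <= M * (Cmod (c 1%nat) / 2) ^ a).
  { rewrite <- Hma at 1.
    replace (M * (Cmod (c 1%nat) / 2) ^ a)
      with (INR (fact a) * (M * ((Cmod (c 1%nat) / 2) ^ a / INR (fact a))))
      by (field; apply INR_fact_neq_0).
    apply Rmult_le_compat_l; [apply pos_INR | exact HM]. }
  unfold Rdiv in Hle; rewrite Rpow_mult_distr, pow_inv in Hle.
  assert (H2 : 0 < 2 ^ a) by (apply pow_lt; lra).
  assert (Hle2 : Cmod (c 1%nat) ^ a * 2 ^ a <= M * Cmod (c 1%nat) ^ a).
  { replace (M * Cmod (c 1%nat) ^ a)
      with (M * (Cmod (c 1%nat) ^ a * / 2 ^ a) * 2 ^ a) by (field; lra).
    apply Rmult_le_compat_r; lra. }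
  nra. }
specialize (Hc (S n)); rewrite Hc1, Cpow_S, Cmult_0_l in Hc.
apply NNPP; intro Hne; apply (Cmult_neq_0 (RtoC (INR (fact (S n)))) (c (S n))); [|exact Hne|exact Hc].
intro E; apply RtoC_inj in E; now apply INR_fact_neq_0 in E.
Qed.

Definition terminates (c : nat -> C) : Prop :=
  exists N, forall n, (N <= n)%nat -> c n = RtoC 0.

Lemma zero_free_terminates c :
  minimal_type c -> (forall z, eval c z <> RtoC 0) -> terminates c.
Proof.
intros H Hnz; exists 1%nat; intros [|n] Hn; [lia|].
assert (Hc0 : c 0%nat <> RtoC 0).
{ intro H0; apply (Hnz (RtoC 0)); rewrite (eval_decr_1 c _ H), H0; ring. }
set (k := (/ c 0%nat)%C).
assert (Hk : k <> RtoC 0).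
{ intro E; assert (E1 : (k * c 0%nat = 1)%C) by (unfold k; now apply Cinv_l).
  rewrite E, Cmult_0_l in E1; apply C1_nz; now symmetry. }
assert (Hm : minimal_type (fun i => k * c i)%C).
{ intros e He; destruct (H e He) as [M HM]; exists (Cmod k * M); intro i.
  rewrite Cmod_mult, Rmult_assoc; apply Rmult_le_compat_l; [apply Cmod_ge_0 | apply HM]. }
assert (He : forall z, eval (fun i => k * c i)%C z = (k * eval c z)%C).
{ intro z; apply (is_Cseries_unique (fun i => (k * c i) * z ^ i)%C).
  { now apply (eval_minimal_type (fun i => k * c i)%C). }
  apply (is_series_ext (K := C_AbsRing) (V := C_NormedModule) (fun i => scal k (c i * z ^ i)%C)).
  { intro i; change (k * (c i * z ^ i) = k * c i * z ^ i)%C; ring. }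
  apply (is_series_scal (K := C_AbsRing) (V := C_NormedModule)).
  now apply eval_minimal_type. }
assert (Hz : (k * c (S n))%C = RtoC 0).
{ apply (zero_free_constant_normalized (fun i => k * c i)%C n Hm).
  - intros z; rewrite He; apply Cmult_neq_0; auto.
  - unfold k; now apply Cinv_l. }
apply NNPP; intro Hne; now apply (Cmult_neq_0 k (c (S n))).
Qed.

Lemma terminates_quotient a c :
  minimal_type c -> terminates (quotient a c) -> terminates c.
Proof.
intros H [N HN]; exists (S N); intros [|n] Hn; [lia|].
rewrite (coef_quotient a c n H), !HN by lia; ring.
Qed.

(** * Series with finitely many zeros *)

(** The zeros of the list are divided out one after the other, each as often
    as possible; what remains has no zeros and is constant. *)
Lemma finite_zeros_terminates l c :
  minimal_type c -> (forall z, eval c z = RtoC 0 -> In z l) -> terminates c.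
Proof.
revert c; induction l as [|a l IHl]; intros c H Hl.
{ now apply zero_free_terminates. }
destruct (classic (forall m, eval (Nat.iter m (quotient a) c) a = RtoC 0)) as [Hz|Hz].
{ exists 0%nat; intros n _; now apply (zero_of_infinite_order a). }
(* The inner induction is on a number of divisions by [z - a] after which
   [a] is no longer a zero; then the shorter list [l] contains all zeros. *)
apply not_all_ex_not in Hz; destruct Hz as [m Hm].
revert c H Hl Hm; induction m as [|m IHm]; intros c H Hl Hm.
- apply IHl; [exact H|]; intros z Hz.
  destruct (Hl z Hz) as [<- | Hin]; [now elim Hm | exact Hin].
- destruct (classic (eval c a = RtoC 0)) as [Ha|Ha].
  + apply (terminates_quotient a c H), IHm.
    * now apply minimal_type_quotient.
    * intros z Hz; apply Hl; rewrite (eval_quotient a c z H), Ha, Hz; ring.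
    * now rewrite Nat.iter_succ_r in Hm.
  + apply IHl; [exact H|]; intros z Hz.
    destruct (Hl z Hz) as [<- | Hin]; [now elim Ha | exact Hin].
Qed.

(** The terms of the convergent series at [z = 1 / e] are bounded. *)
Lemma minimal_type_of_conv c :
  (forall z : C, @ex_pseries C_AbsRing C_NormedModule
     (fun n : nat => Cmult (RtoC (INR (fact n))) (c n)) z) ->
  minimal_type c.
Proof.
intros H e He.
destruct (H (RtoC (/ e))) as [l Hl].
pose (t := fun n => (RtoC (/ e) ^ n * (RtoC (INR (fact n)) * c n))%C).
assert (Ht : forall n, Cmod (t n) = (/ e) ^ n * (INR (fact n) * Cmod (c n))).
{ intro n; unfold t; rewrite !Cmod_mult, Cmod_pow, !Cmod_R, !Rabs_pos_eq;
    [reflexivity | apply pos_INR | left; now apply Rinv_0_lt_compat]. }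
assert (Hser : is_Cseries t l).
{ apply (is_series_ext (K := C_AbsRing) (V := C_NormedModule)) with (2 := Hl).
  intro n; unfold t; change scal with Cmult; f_equal. }
assert (Hb : exists M, forall n, Cmod (t n) <= M).
{ destruct (filterlim_bounded (K := C_AbsRing) (V := C_NormedModule)
    (sum_n (G := C_AbelianMonoid) t)) as [M HM]; [now exists l|].
  exists (M + M); intros [|n].
  - specialize (HM 0%nat); rewrite sum_O in HM; change norm with Cmod in HM.
    pose proof (Cmod_ge_0 (t 0%nat)); lra.
  - replace (t (S n)) with (sum_n (G := C_AbelianMonoid) t (S n) + - sum_n (G := C_AbelianMonoid) t n)%C.
    + eapply Rle_trans; [apply Cmod_triangle|]; rewrite Cmod_opp.
      apply Rplus_le_compat; apply HM.
    + rewrite sum_Sn; change plus with Cplus; ring. }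
destruct Hb as [M HM]; exists M; intro n; specialize (HM n); rewrite Ht in HM.
replace (Cmod (c n)) with ((/ e) ^ n * (INR (fact n) * Cmod (c n)) * (e ^ n / INR (fact n))).
- apply Rmult_le_compat_r; [|exact HM].
  apply Rdiv_le_0_compat; [apply pow_le; lra | apply INR_fact_lt_0].
- rewrite pow_inv; field; split; [apply INR_fact_neq_0 | apply pow_nonzero; lra].
Qed.

Theorem theorem1p1 (c : nat -> C)
  (hconv : forall z : C,
     @ex_pseries C_AbsRing C_NormedModule
       (fun n : nat => Cmult (RtoC (INR (fact n))) (c n)) z)
  (hc : does_not_terminate c) :
  exists f : C -> C,
    is_power_series_sum c f /\
    entire f /\
    infinitely_many (fun z : C => f z = RtoC 0).
Proof.
pose proof (minimal_type_of_conv c hconv) as H.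
exists (eval c); split; [|split].
- intro z; apply (is_series_ext (K := C_AbsRing) (V := C_NormedModule)) with (2 := eval_minimal_type c z H).
  intro n; change scal with Cmult; rewrite Cmult_comm; f_equal.
- now apply entire_eval.
- intros [l Hl]; apply hc.
  destruct (finite_zeros_terminates l c H Hl) as [N HN].
  exists (seq 0 N); intros n Hn; apply in_seq; split; [lia|].
  destruct (Nat.lt_ge_cases n N) as [Hlt|Hge]; [lia|].
  elim Hn; now apply HN.
Qed.
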